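(* Let $G$ be a finite connected undirected graph (multiple edges and loops allowed). Any two partial orientations $\mathcal{O}$ and $\mathcal{O}'$ of $G$ which have the same indegree sequence are related by an edge disjoint union of cycle reversals and Jacob's ladder cascades; that is, there is a finite (possibly empty) collection of pairwise edge-disjoint directed cycles and half open paths in $\mathcal{O}$ such that reversing each of these directed cycles and performing the Jacob's ladder cascade along each of these half open paths transforms $\mathcal{O}$ into $\mathcal{O}'$.
   Context: A partial orientation of $G$ is an orientation of a subset of the edges; the remaining edges are unoriented (each edge, including each loop, has two possible orientations or is unoriented; an oriented loop at $v$ is oriented towards $v$ in either orientation). The indegree sequence of a partial orientation is the vector whose $i$-th entry is the number of edges oriented towards the $i$-th vertex. A directed cycle in a partial orientation is a cycle of $G$ all of whose edges are oriented, consistently along the cycle; an oriented loop is a directed cycle of length 1, and two parallel edges oriented oppositely form a directed cycle of length 2. A cycle reversal reverses the orientation of all edges in a directed cycle. Given a vertex $v$ incident to an unoriented edge $e$ and an edge $e'$ oriented towards $v$, an edge pivot is the operation of unorienting $e'$ and orienting $e$ towards $v$. A half open path in a partial orientation consists of a directed path with at least one edge (a directed walk $v_0\to v_1\to\dots\to v_k$, $k\ge1$, along distinct oriented edges) together with an unoriented edge $e$ incident to its terminal vertex $v_k$, where $e$ is regarded as having the orientation that extends the path, i.e. pointing away from $v_k$ (if $e$ is a loop, either of its two orientations may be taken). The edges of the half open path are the edges of the directed path together with $e$. The Jacob's ladder cascade along this half open path is the sequence of edge pivots at $v_k, v_{k-1},\dots,v_1$ which reverses the orientation of its edges: the result is that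 $e$ becomes oriented towards $v_k$ (opposite to its regarded orientation), the edges $v_{i-1}\to v_i$ with $2\le i\le k$ are reversed to $v_i\to v_{i-1}$, and the first edge $v_0v_1$ becomes unoriented. *)

(* Defs.v *)
From mathcomp Require Import all_boot.

Set Implicit Arguments.
Unset Strict Implicit.
Unset Printing Implicit Defensive.

(* The two ends of an edge are indexed by bool, so that every edge, loops
   included, has exactly two orientations: orientation [b] of [e] goes from
   [endpt e (~~ b)] to [endpt e b]. The labelling of the ends by [true] and
   [false] is arbitrary. *)
Record multigraph := Multigraph {
  vertex : finType;
  edge : finType;
  endpt : edge -> bool -> vertex
}.

Section Multigraph.

Variable G : multigraph.

Definition adjacent : rel (vertex G) := fun u v =>
  [exists e : edge G, exists b, (endpt e b == u) && (endpt e (~~ b) == v)].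

Definition connected : Prop := forall u v : vertex G, connect adjacent u v.

(* An edge together with one of its two orientations. *)
Definition dart : Type := (edge G * bool)%type.

Definition dhead (d : dart) : vertex G := endpt d.1 d.2.
Definition dtail (d : dart) : vertex G := endpt d.1 (~~ d.2).
Definition dflip (d : dart) : dart := (d.1, ~~ d.2).
Definition consecutive : rel dart := fun d d' => dhead d == dtail d'.

(* [None] means unoriented. *)
Definition partial_orientation : Type := {ffun edge G -> option bool}.

Implicit Types (O : partial_orientation) (d : dart) (c p : seq dart).

Definition oriented_as O : pred dart := fun d => O d.1 == Some d.2.

Definition oriented_towards O (v : vertex G) : pred (edge G) := fun e =>
  [exists b, (O e == Some b) && (endpt e b == v)].

Definition indegree_sequence O : {ffun vertex G -> nat} :=
  [ffun v => #|[set e | oriented_towards O v e]|].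

Definition dart_edges p : seq (edge G) := map fst p.

(* A cycle of G with a direction of traversal: no vertex and no edge is
   repeated. Loops are the cycles of length 1, and pairs of parallel edges
   the cycles of length 2. *)
Definition graph_cycle c : bool :=
  [&& c != [::], cycle consecutive c, uniq (map dhead c)
    & uniq (dart_edges c)].

Definition directed_cycle O c : bool := graph_cycle c && all (oriented_as O) c.

Definition reverse_cycle O c : partial_orientation :=
  [ffun e => if e \in dart_edges c then omap negb (O e) else O e].

(* The edge pivot at [dhead d] that unorients [e'] and gives the edge of [d]
   the orientation of [d]. It is only meaningful when the edge of [d] is
   unoriented and [e'] is oriented towards [dhead d]. *)
Definition edge_pivot O d (e' : edge G) : partial_orientation :=
  [ffun f => if f == d.1 then Some d.2 else if f == e' then None else O f].

(* [(p, d)] is the directed path [p] followed by the unoriented edge [d.1],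
   regarded as having the orientation [d.2]. If [d.1] is a loop then both
   values of [d.2] are possible. Vertices may be repeated. *)
Definition half_open_path O (h : seq dart * dart) : bool :=
  let: (p, d) := h in
  [&& p != [::], all (oriented_as O) p, uniq (dart_edges p),
      O d.1 == None & sorted consecutive (rcons p d)].

Definition half_open_edges (h : seq dart * dart) : seq (edge G) :=
  dart_edges (rcons h.1 h.2).

(* [q] lists the darts of the path from the last one to the first one, and
   [d] is the dart following them, whose edge is currently unoriented. *)
Fixpoint pivots O d (q : seq dart) : partial_orientation :=
  if q is d' :: q' then pivots (edge_pivot O (dflip d) d'.1) d' q' else O.

Definition cascade O (h : seq dart * dart) : partial_orientation :=
  pivots O h.2 (rev h.1).

Definition edge_disjoint : rel (seq (edge G)) := fun s t => [disjoint s & t].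

End Multigraph.

(* Main.v *)
Require Import Defs.
From mathcomp Require Import all_boot.

(** Let [T] be the target orientation and look at the edges on which [O] and
    [T] differ. Direct such an edge as [O] does if [O] orients it, and against
    [T] otherwise. It is then of one of three kinds: reversed (oriented by
    both), lost (oriented by [O] only) or gained (oriented by [T] only). A
    reversed or lost dart counts in the [O]-indegree of its head, a reversed or
    gained dart counts in the [T]-indegree of its tail. Hence equality of
    the indegree sequences says that at every vertex the reversed or lost darts
    coming in are as many as the reversed or gained darts going out
    ([next_dart] is the consequence that matters).

    A graph cycle of reversed darts can be reversed. This makes [O] agree with
    [T] on its edges, and changes no indegree because the tails along a closed
    walk are its heads, cyclically shifted. After finitely many steps no cycle
    of reversed darts is left. Then a walk which starts with a lost dart and
    continues along reversed darts can never return to a dart that it has used,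
    so it is stopped, and only a gained dart can stop it ([gained_trail]): the
    walk is a half open path, and its cascade makes [O] agree with [T] on all
    of its edges. A lost dart exists as long as [O] and [T] differ, because
    they orient equally many edges in total.

    Both operations replace [O] by [graft O T s] for a set [s] of edges on which
    [O] and [T] differ. The later cycles and paths only use edges where the
    current orientation still differs from [T]; these lie outside [s] and
    still have their original orientation, which gives edge-disjointness and
    validity in the original [O]. *)

Set Implicit Arguments.
Unset Strict Implicit.
Unset Printing Implicit Defensive.

Section PartialOrientations.

Variable G : multigraph.
Implicit Types (O T : partial_orientation G) (d : dart G) (c p q : seq (dart G)).
Implicit Types (e : edge G) (v : vertex G) (s : seq (edge G)).
Implicit Types (h : seq (dart G) * dart G).

(** * Walks and cycles *)

Lemma path_tails_heads d q :
  path (@consecutive G) d q -> map (@dtail G) q = map (@dhead G) (belast d q).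
Proof. by elim: q d => //= x q IHq d /andP[/eqP-> /IHq ->]. Qed.

Lemma map_not_uniq_split (A B : eqType) (f : A -> B) (r : seq A) :
  ~~ uniq (map f r) ->
  exists r1 a r2 b r3, r = r1 ++ a :: r2 ++ b :: r3 /\ f a = f b.
Proof.
elim: r => //= a r IHr; rewrite negb_and negbK => /orP[/mapP[b br fab]|].
  by case/splitPr: br => r2 r3; exists [::], a, r2, b, r3.
move=> /IHr[r1 [a' [r2 [b [r3 [-> fab]]]]]].
by exists (a :: r1), a', r2, b, r3.
Qed.

Lemma oriented_uniq_edges O c :
  all (oriented_as O) c -> uniq (dart_edges c) = uniq c.
Proof.
move=> /allP Oc; apply: map_inj_in_uniq => -[e b] [e' b'] /Oc/eqP/= Oe.
by move=> /Oc/eqP/= + /= ee; rewrite -ee Oe => -[->].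
Qed.

(** A closed walk that comes back to a vertex too early contains a shorter
    closed walk, so a shortest one visits every vertex at most once. It then
    repeats no edge either, since an oriented edge has only one head. *)
Lemma closed_walk_cycle O c :
  c != [::] -> cycle (@consecutive G) c -> all (oriented_as O) c ->
  exists2 c', directed_cycle O c' & {subset c' <= c}.
Proof.
have [n] := ubnP (size c); elim: n c => // n IHn c ltcn c0 cc Oc.
have [hu | /map_not_uniq_split] := boolP (uniq (map (@dhead G) c)).
  exists c => //; rewrite /directed_cycle /graph_cycle c0 cc hu Oc /= andbT.
  by rewrite (oriented_uniq_edges Oc) (map_uniq hu).
case=> p1 [x [p2 [y [p3 [cE xy]]]]]; rewrite {}cE in ltcn cc Oc *.
have sc : {subset rcons p2 y <= p1 ++ x :: p2 ++ y :: p3}.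
  move=> z; rewrite mem_rcons !(inE, mem_cat).
  by case/orP=> ->; rewrite ?orbT.
have [||||c' c'P c's] := IHn (rcons p2 y).
- move: ltcn; rewrite size_rcons !size_cat /= size_cat /= ltnS.
  by apply: leq_trans; apply: leq_trans (leq_addl _ _); rewrite addnS !ltnS leq_addr.
- by case: (p2).
- have: sorted (@consecutive G) (p1 ++ x :: p2 ++ y :: p3).
    move: cc; case: (p1 ++ _) => //= z r.
    by rewrite rcons_path => /andP[].
  move/cat_sorted2=> [_] /=; rewrite -cat_rcons cat_path => /andP[+ _].
  (* Only the heads of [x] and [y] matter to what may follow them. *)
  suff -> : cycle (@consecutive G) (rcons p2 y)
    = path (@consecutive G) x (rcons p2 y) by [].
  case: (p2) => [|z r] /=; first by rewrite /consecutive xy.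
  by rewrite rcons_path last_rcons {2 3}/consecutive xy andbC.
- by apply/allP=> z /sc; apply: (allP Oc).
by exists c' => // z /c's /sc.
Qed.

(** * Indegrees *)

Lemma oriented_towardsE O d v :
  O d.1 = Some d.2 -> oriented_towards O v d.1 = (dhead d == v).
Proof.
move=> Od; apply/existsP/idP => [[b /andP[]]|dv].
  by rewrite Od => /eqP[<-].
by exists d.2; rewrite Od eqxx.
Qed.

Lemma oriented_towards_flip T d v :
  T d.1 = Some (~~ d.2) -> oriented_towards T v d.1 = (dtail d == v).
Proof. exact: (@oriented_towardsE T (dflip d)). Qed.

Lemma oriented_towardsN O e v :
  O e = None -> oriented_towards O v e = false.
Proof. by move=> Oe; apply/existsP=> -[b]; rewrite Oe. Qed.

Lemma sum_indegree O :
  \sum_v indegree_sequence O v = #|[set e | O e != None]|.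
Proof.
under eq_bigr do rewrite ffunE cardsE -sum1_card big_mkcond.
rewrite exchange_big -sum1_card [RHS]big_mkcond /=.
apply: eq_bigr => e _; rewrite inE; case Oe: (O e) => [b|]; last first.
  by rewrite big1 // => v _; rewrite [e \in _]oriented_towardsN.
rewrite (bigD1 (endpt e b)) //= big1 => [|v /negPf nv];
  rewrite [e \in _](@oriented_towardsE _ (e, b)) //=.
  by rewrite /dhead eqxx.
by rewrite /dhead eq_sym nv.
Qed.

(** An edge that counts in the [O]-indegree of a vertex but not in its
    [T]-indegree is compensated there by another edge for which it is the other
    way round. The one exception is a reversed loop, which follows itself. *)
Lemma next_dart O T d :
  indegree_sequence O = indegree_sequence T ->
  O d.1 = Some d.2 -> O d.1 != T d.1 ->
  exists d', [/\ consecutive d d', T d'.1 = Some (~~ d'.2) & O d'.1 != T d'.1].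
Proof.
move=> OT Od neq; have [/existsP[b /andP[/eqP Tb /eqP bd]]|nT] :=
  boolP (oriented_towards T (dhead d) d.1).
  have bE : b = ~~ d.2.
    by move: neq; rewrite Od Tb; case: (b) (d.2) => -[].
  exists d; rewrite -bE; split=> //.
  by rewrite /consecutive /dtail -bE bd.
set S := [set e | oriented_towards O (dhead d) e].
set S' := [set e | oriented_towards T (dhead d) e].
(* [S] and [S'] have the same size and [d.1] lies in [S] only, so some edge
   lies in [S'] only. *)
have cardS : #|S| = #|S'|.
  by have := congr1 (fun f : {ffun _ -> _} => f (dhead d)) OT; rewrite !ffunE.
have dS : d.1 \in S by rewrite inE oriented_towardsE.
have /subsetPn[e] : ~~ (S' \subset S).
  apply/negP=> sS; have /eqP SE : S' == S by rewrite eqEcard sS cardS leqnn.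
  by move: dS nT; rewrite -SE inE => ->.
rewrite !inE => /existsP[b /andP[/eqP Tb /eqP bd]] nO.
exists (e, ~~ b); rewrite /consecutive /dtail /= negbK bd eqxx Tb; split=> //.
by apply: contra nO => /eqP Ob; apply/existsP; exists b; rewrite Ob bd !eqxx.
Qed.

(** * Replacing an orientation on a set of edges *)

Definition graft O T s : partial_orientation G :=
  [ffun e => if e \in s then T e else O e].

Lemma graft_neq O T s e :
  graft O T s e != T e -> [/\ e \notin s, graft O T s e = O e & O e != T e].
Proof. by rewrite ffunE; case: ifP => //; rewrite eqxx. Qed.

Lemma graft_indegree O T s :
    uniq s ->
    (forall v, count (oriented_towards T v) s = count (oriented_towards O v) s) ->
  indegree_sequence (graft O T s) = indegree_sequence O.
Proof.
move=> us cs; apply/ffunP=> v; rewrite !ffunE !cardsE -!sum1_card.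
have countE O1 : \sum_(e in oriented_towards O1 v) 1 =
    count (oriented_towards O1 v) s
    + \sum_(e in oriented_towards O1 v | e \notin s) 1.
  rewrite (bigID (mem s)) /=; congr (_ + _).
  rewrite -sum1_count [RHS]big_mkcond big_uniq //= -big_mkcondr /=.
  by apply: eq_bigl => e; rewrite andbC.
rewrite !{}countE -cs; congr (_ + _).
  apply: eq_in_count => e es; apply: eq_existsb => b.
  by rewrite ffunE es.
apply: eq_bigl => e; case: (boolP (e \in s)) => es; rewrite ?andbF //= !andbT.
by apply: eq_existsb => b; rewrite ffunE (negPf es).
Qed.

Lemma graft_card_lt O T s :
  s != [::] -> {in s, forall e, O e != T e} ->
  #|[set e | graft O T s e != T e]| < #|[set e | O e != T e]|.
Proof.
case: s => // e s _ sD; apply: proper_card; apply/properP; split.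
  by apply/subsetP=> f; rewrite !inE => /graft_neq[].
exists e; first by rewrite inE sD ?mem_head.
by rewrite inE ffunE mem_head eqxx.
Qed.

(** * Cycles of reversed darts *)

Definition reversed_dart O T d := (O d.1 == Some d.2) && (T d.1 == Some (~~ d.2)).

Lemma reversed_neq O T d : reversed_dart O T d -> O d.1 != T d.1.
Proof. by case/andP=> /eqP-> /eqP->; case: d.2. Qed.

Lemma count_towards_heads O c v : all (oriented_as O) c ->
  count (oriented_towards O v) (dart_edges c) = count_mem v (map (@dhead G) c).
Proof.
move=> /allP Oc; rewrite !count_map; apply: eq_in_count => d /Oc/eqP Od.
exact: oriented_towardsE.
Qed.

Lemma count_towards_tails T c v : {in c, forall d, T d.1 = Some (~~ d.2)} ->
  count (oriented_towards T v) (dart_edges c) = count_mem v (map (@dtail G) c).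
Proof.
move=> Tc; rewrite !count_map; apply: eq_in_count => d /Tc Td.
exact: oriented_towards_flip.
Qed.

Lemma reverse_cycle_graft O T c :
  all (reversed_dart O T) c -> reverse_cycle O c = graft O T (dart_edges c).
Proof.
move=> /allP cR; apply/ffunP=> e; rewrite !ffunE; case: ifP => // /mapP[d dc ->].
by case/andP: (cR d dc) => /eqP-> /eqP->.
Qed.

Lemma reverse_cycle_indegree O T c :
  graph_cycle c -> all (reversed_dart O T) c ->
  indegree_sequence (graft O T (dart_edges c)) = indegree_sequence O.
Proof.
case/and4P=> _ cc _ ue /allP cR; apply: graft_indegree => // v.
rewrite (@count_towards_heads O); last by apply/allP=> d /cR/andP[].
rewrite (@count_towards_tails T); last by move=> d /cR/andP[_ /eqP].
case: c cc {ue cR} => //= d q /path_tails_heads/(congr1 (count_mem v)).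
by rewrite map_rcons belast_rcons -cats1 count_cat /= addn0 addnC.
Qed.

(** * Half open paths from a lost dart to a gained dart *)

Definition reversed_acyclic O T :=
  forall c, graph_cycle c -> ~~ all (reversed_dart O T) c.

Variant reversed_acyclic_spec O T : Prop :=
  | ReversedCycle c of graph_cycle c && all (reversed_dart O T) c
  | ReversedAcyclic of reversed_acyclic O T.

(** Graph cycles repeat no edge, so there are finitely many of them to try. *)
Lemma reversed_acyclicP O T : reversed_acyclic_spec O T.
Proof.
have [/existsP[c]|/existsPn noc] := boolP [exists c : #|edge G|.-bseq (edge G * bool),
    graph_cycle (c : seq (dart G)) && all (reversed_dart O T) c].
  exact: ReversedCycle.
apply: ReversedAcyclic => c cG.
have sz : size c <= #|edge G|.
  case/and4P: cG => _ _ _ /card_uniqP ce.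
  by rewrite -(size_map fst) -[size _]ce max_card.
by have := noc (Bseq sz); rewrite cG.
Qed.

Lemma reversed_acyclic_graft O T s :
  reversed_acyclic O T -> reversed_acyclic (graft O T s) T.
Proof.
move=> acO c /acO; apply: contra => /allP cR; apply/allP=> d dc.
have /[dup] /reversed_neq/graft_neq[_ gO _] := cR d dc.
by rewrite /reversed_dart gO.
Qed.

(** The trail is extended one dart at a time as provided by [next_dart]. If the
    new dart is reversed and was used before, then the part of the trail since
    that use is a closed walk of reversed darts, against acyclicity. *)
Lemma gained_trail O T d :
  indegree_sequence O = indegree_sequence T -> reversed_acyclic O T ->
  O d.1 = Some d.2 -> O d.1 != T d.1 ->
  exists q x, [/\ path (@consecutive G) d (rcons q x), uniq (d :: q),
    all (reversed_dart O T) q, O x.1 = None & T x.1 = Some (~~ x.2)].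
Proof.
move=> OT acO Od dneq.
suff extend n q : #|{: edge G * bool}| - size q <= n ->
    path (@consecutive G) d q -> uniq (d :: q) -> all (reversed_dart O T) q ->
  exists q' x, [/\ path (@consecutive G) d (rcons q' x), uniq (d :: q'),
    all (reversed_dart O T) q', O x.1 = None & T x.1 = Some (~~ x.2)].
  exact: (extend _ [::] (leqnn _)).
elim: n q => [|n IHn] q sz pq uq qR.
  move: sz; rewrite leqn0 subn_eq0 leqNgt.
  by have := max_card [in d :: q]; rewrite (card_uniqP uq) /= => ->.
have [Ol lneq] : O (last d q).1 = Some (last d q).2
    /\ O (last d q).1 != T (last d q).1.
  have := mem_last d q; rewrite inE => /predU1P[->//|/(allP qR) lR].
  by rewrite (reversed_neq lR); case/andP: lR => /eqP.
have [x [lx Tx xneq]] := next_dart OT Ol lneq.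
case Ox: (O x.1) => [b|]; last first.
  by exists q, x; rewrite rcons_path pq lx.
have xR : reversed_dart O T x.
  by move: xneq; rewrite /reversed_dart Ox Tx eqxx andbT; case: (b) (x.2) => -[].
apply: (IHn (rcons q x)); last by rewrite all_rcons xR.
- by rewrite size_rcons subnS; case: (_ - _) sz.
- by rewrite rcons_path pq lx.
have not_closed p : path (@consecutive G) x p -> all (reversed_dart O T) p ->
    ~ consecutive (last x p) x.
  move=> px pR lpx; have [|||c' /andP[c'c _] c's] := @closed_walk_cycle O (x :: p).
  - by [].
  - by rewrite /= rcons_path px.
  - rewrite /= {1}/oriented_as Ox; case/andP: xR; rewrite Ox => -> _ /=.
    by apply: sub_all pR => y /andP[].
  have /negP[] := acO c' c'c; apply/allP=> y /c's; rewrite inE.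
  by move=> /predU1P[->//|]; apply: (allP pR).
rewrite -rcons_cons rcons_uniq uq andbT inE; apply/negP=> /predU1P[xd|xq].
  by rewrite -xd in pq lx; apply: (not_closed q).
case/splitPr: xq pq qR lx {sz uq Ol lneq} => p1 p2.
rewrite cat_path last_cat all_cat /= => /and3P[_ _ xp2] /and3P[_ _ p2R] lx.
exact: (not_closed p2).
Qed.

(** Both orientations orient equally many edges, since the indegrees add up to
    that number. Hence, if no dart is lost, then none is gained; but a trail
    starting at any dart on which [O] and [T] differ ends in a gained one. *)
Lemma exists_lost_dart O T :
    indegree_sequence O = indegree_sequence T -> reversed_acyclic O T ->
    O != T ->
  exists d, O d.1 = Some d.2 /\ T d.1 = None.
Proof.
move=> OT acO neq.
have [/existsP[e]|/existsPn noB] := boolP [exists e, (O e != None) && (T e == None)].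
  by case Oe: (O e) => [b|//] /eqP Te; exists (e, b).
have sOT : [set e | O e != None] \subset [set e | T e != None].
  apply/subsetP=> e; rewrite !inE => Oe; apply: contraNneq (noB e) => ->.
  by rewrite Oe eqxx.
have NoneE e : (O e == None) = (T e == None).
  have /eqP/setP/(_ e) : [set e | O e != None] == [set e | T e != None].
    by rewrite eqEcard sOT -!sum_indegree OT leqnn.
  by rewrite !inE => /negb_inj.
have [e eneq] : exists e, O e != T e.
  apply/existsP; apply: contraNT neq => /existsPn OTe; apply/eqP/ffunP=> e.
  by apply/eqP; have := OTe e; rewrite negbK.
case Oe: (O e) => [b|]; last first.
  by move: eneq (NoneE e); rewrite Oe eqxx => /eqP nT /esym/eqP /esym.
have [q [x [_ _ _ Ox Tx]]] := @gained_trail O T (e, b) OT acO Oe eneq.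
by have := NoneE x.1; rewrite Ox Tx eqxx.
Qed.

(** The pivots turn around every dart of the list [d :: q] except the last
    one, which they unorient. *)
Lemma pivots_graft O T d q :
    q != [::] -> uniq (dart_edges (d :: q)) ->
    {in belast d q, forall x, T x.1 = Some (~~ x.2)} -> T (last d q).1 = None ->
  pivots O d q = graft O T (dart_edges (d :: q)).
Proof.
elim: q d O => // d' q IHq d O _ /= /andP[dq uq] Tq Tl.
have Td : T d.1 = Some (~~ d.2) by apply: Tq; rewrite mem_head.
have [q0|q0] := eqVneq q [::].
  rewrite {}q0 /= in Tl *; apply/ffunP=> e; rewrite !ffunE !inE /=.
  by case: (eqVneq e d.1) => [->|_] //; case: eqVneq => [->|_].
rewrite IHq //=; last by move=> x xq; apply: Tq; rewrite inE xq orbT.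
apply/ffunP=> e; rewrite !ffunE !inE /=; case: (eqVneq e d'.1) => [|_] //=.
  by rewrite orbT.
by have [->|_] := eqVneq e d.1; rewrite //= Td; case: ifP.
Qed.

Lemma cascade_graft O T d q x :
    uniq (half_open_edges (d :: q, x)) ->
    T d.1 = None -> all (reversed_dart O T) q -> T x.1 = Some (~~ x.2) ->
  cascade O (d :: q, x) = graft O T (half_open_edges (d :: q, x)).
Proof.
move=> uh Td /allP qR Tx; have hE : half_open_edges (d :: q, x)
  =i dart_edges (x :: rcons (rev q) d).
  move=> e; rewrite -[RHS]mem_rev -map_rev rev_cons rev_rcons revK.
  by rewrite /half_open_edges.
rewrite /cascade /= rev_cons (@pivots_graft _ T).
- by apply/ffunP=> e; rewrite !ffunE hE.
- by case: (rev q).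
- rewrite -(rev_uniq) -map_rev rev_cons rev_rcons revK.
  exact: uh.
- rewrite belast_rcons => y; rewrite inE mem_rev.
  by case/predU1P=> [->//|/qR/andP[_ /eqP]].
by rewrite last_rcons.
Qed.

(** At every vertex, the [O]-indegree due to the trail counts the heads of all
    its darts but the gained one at its end, and the [T]-indegree the tails of
    all its darts but the lost one at its beginning. *)
Lemma cascade_indegree O T d q x :
    path (@consecutive G) d (rcons q x) -> uniq (half_open_edges (d :: q, x)) ->
    O d.1 = Some d.2 -> T d.1 = None -> all (reversed_dart O T) q ->
    O x.1 = None -> T x.1 = Some (~~ x.2) ->
  indegree_sequence (graft O T (half_open_edges (d :: q, x)))
  = indegree_sequence O.
Proof.
move=> dqx uh Od Td /allP qR Ox Tx; apply: graft_indegree => // v.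
rewrite /half_open_edges /= oriented_towardsN // add0n.
rewrite count_towards_tails; last first.
  by move=> y; rewrite mem_rcons inE => /predU1P[->//|/qR/andP[_ /eqP]].
rewrite (path_tails_heads dqx) belast_rcons -(@count_towards_heads O); last first.
  by rewrite /= /oriented_as Od eqxx; apply/allP=> y /qR/andP[].
by rewrite /dart_edges map_rcons -cats1 count_cat /= (oriented_towardsN v Ox) !addn0.
Qed.

(** * Decomposition *)

Definition differ O T : pred (edge G) := fun e => O e != T e.

(** This lets cycles and paths found after a graft be used before it. *)
Lemma differ_graft O T s s' :
  all (differ (graft O T s) T) s' ->
  [/\ {in s', graft O T s =1 O}, all (differ O T) s' & edge_disjoint s s'].
Proof.
move=> /allP s'D; split.
- by move=> e /s'D/graft_neq[].
- by apply/allP=> e /s'D/graft_neq[].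
by rewrite /edge_disjoint disjoint_sym disjoint_has -all_predC;
  apply/allP=> e /s'D/graft_neq[].
Qed.

Lemma all_oriented_as_eq O O1 c :
  {in dart_edges c, O1 =1 O} -> all (oriented_as O1) c = all (oriented_as O) c.
Proof.
by move=> eO; apply: eq_in_all => d dc; rewrite /oriented_as eO ?map_f.
Qed.

Lemma directed_cycle_eq O O1 c :
  {in dart_edges c, O1 =1 O} -> directed_cycle O1 c = directed_cycle O c.
Proof. by move=> eO; rewrite /directed_cycle (all_oriented_as_eq eO). Qed.

Lemma half_open_path_eq O O1 h :
  {in half_open_edges h, O1 =1 O} -> half_open_path O1 h = half_open_path O h.
Proof.
case: h => p d eO; rewrite /half_open_path (@all_oriented_as_eq O).
  by rewrite eO // map_f // mem_rcons mem_head.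
by move=> e ep; apply: eO; rewrite /half_open_edges /dart_edges map_rcons
  mem_rcons inE [e \in _]ep orbT.
Qed.

(** A cascade creates no reversed dart, hence no cycle of them, so once the
    cycles are exhausted cascades suffice. That the edges used are among those
    on which [O] and [T] differ is part of the induction: by [differ_graft] it
    makes the later paths disjoint from the present one. *)
Lemma cascade_decomposition O T :
    indegree_sequence O = indegree_sequence T -> reversed_acyclic O T ->
  exists hs : seq (seq (dart G) * dart G),
    [/\ all (half_open_path O) hs,
        all (all (differ O T)) (map (@half_open_edges G) hs),
        pairwise (@edge_disjoint G) (map (@half_open_edges G) hs)
      & foldl (@cascade G) O hs = T].
Proof.
have [n] := ubnP #|[set e | O e != T e]|.
elim: n O => // n IHn O ltn OT acO.
have [->|neq] := eqVneq O T; first by exists [::].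
have [d [Od Td]] := exists_lost_dart OT acO neq.
have dneq : O d.1 != T d.1 by rewrite Od Td.
have [q [x [dqx udq qR Ox Tx]]] := gained_trail OT acO Od dneq.
pose h := (d :: q, x).
have dqO : all (oriented_as O) (d :: q).
  by rewrite /= {1}/oriented_as Od eqxx; apply: sub_all qR => y /andP[].
have ue : uniq (dart_edges (d :: q)) by rewrite (oriented_uniq_edges dqO).
have uh : uniq (half_open_edges h).
  rewrite /half_open_edges /dart_edges map_rcons rcons_uniq [uniq _]ue andbT.
  by apply/mapP=> -[y /(allP dqO)/eqP + xy]; rewrite -xy Ox.
have hD : all (differ O T) (half_open_edges h).
  rewrite /half_open_edges /dart_edges all_map all_rcons /= /differ Ox Tx dneq /=.
  by apply: sub_all qR => y /reversed_neq.
have hO : half_open_path O h.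
  by apply/and5P; split=> //=; rewrite Ox.
have [|||hs [hsO hsD hsP hsT]] := IHn (graft O T (half_open_edges h)).
- by move: ltn; rewrite ltnS; apply: leq_trans; apply: graft_card_lt => //; apply/allP.
- by rewrite cascade_indegree.
- exact: reversed_acyclic_graft.
have hsE k : k \in hs -> [/\ {in half_open_edges k, graft O T (half_open_edges h) =1 O},
    all (differ O T) (half_open_edges k)
    & edge_disjoint (half_open_edges h) (half_open_edges k)].
  by move=> khs; apply/differ_graft/(allP hsD)/map_f.
exists (h :: hs); split.
- apply/andP; split=> //; apply/allP=> k /[dup] /hsE[kE _ _] /(allP hsO).
  by rewrite (half_open_path_eq kE).
- by apply/andP; split=> //; apply/allP=> _ /mapP[k /hsE[_ kD _] ->].
- rewrite map_cons pairwise_cons hsP andbT.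
  by apply/allP=> _ /mapP[k /hsE[_ _ kd] ->].
by rewrite /= (cascade_graft uh Td).
Qed.

(** Reversing the cycles first matches the order in which the operations are
    applied in the conclusion. *)
Lemma reversal_decomposition O T :
    indegree_sequence O = indegree_sequence T ->
  exists (cs : seq (seq (dart G))) (hs : seq (seq (dart G) * dart G)),
    [/\ all (directed_cycle O) cs,
        all (half_open_path O) hs,
        all (all (differ O T))
          (map (@dart_edges G) cs ++ map (@half_open_edges G) hs),
        pairwise (@edge_disjoint G)
          (map (@dart_edges G) cs ++ map (@half_open_edges G) hs)
      & foldl (@cascade G) (foldl (@reverse_cycle G) O cs) hs = T].
Proof.
have [n] := ubnP #|[set e | O e != T e]|.
elim: n O => // n IHn O ltn OT.
have [c /andP[cG cR]|acO] := reversed_acyclicP O T; last first.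
  have [hs [hsO hsD hsP hsT]] := cascade_decomposition OT acO.
  by exists [::], hs; split.
have cD : all (differ O T) (dart_edges c).
  by rewrite all_map; apply: sub_all cR => d /reversed_neq.
have cO : directed_cycle O c.
  by rewrite /directed_cycle cG; apply: sub_all cR => d /andP[].
have [||cs [hs [csO hsO csD csP csT]]] := IHn (graft O T (dart_edges c)).
- move: ltn; rewrite ltnS; apply: leq_trans; apply: graft_card_lt; last exact/allP.
  by case: (c) cG.
- by rewrite reverse_cycle_indegree.
have sE s : s \in map (@dart_edges G) cs ++ map (@half_open_edges G) hs ->
    [/\ {in s, graft O T (dart_edges c) =1 O}, all (differ O T) s
    & edge_disjoint (dart_edges c) s].
  by move=> /(allP csD)/differ_graft.
exists (c :: cs), hs; split.
- apply/andP; split=> //; apply/allP=> c' c'cs; have := allP csO c' c'cs.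
  rewrite (@directed_cycle_eq O) //.
  by have [] := sE (dart_edges c'); rewrite // mem_cat map_f.
- apply/allP=> h hhs; have := allP hsO h hhs.
  rewrite (@half_open_path_eq O) //.
  by have [] := sE (half_open_edges h); rewrite // mem_cat orbC map_f.
- by apply/andP; split=> //; apply/allP=> s /sE[].
- by rewrite map_cons cat_cons pairwise_cons csP andbT; apply/allP=> s /sE[].
by rewrite /= (reverse_cycle_graft cR).
Qed.

End PartialOrientations.

Theorem lemma3p9 (G : multigraph) (O O' : partial_orientation G)
    (hG : connected G)
    (hO : indegree_sequence O = indegree_sequence O') :
  exists (cs : seq (seq (dart G))) (hs : seq (seq (dart G) * dart G)),
    [/\ all (directed_cycle O) cs,
        all (half_open_path O) hs,
        pairwise (@edge_disjoint G)
          (map (@dart_edges G) cs ++ map (@half_open_edges G) hs)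
      & foldl (@cascade G) (foldl (@reverse_cycle G) O cs) hs = O'].
Proof.
have [cs [hs [csO hsO _ disj csT]]] := reversal_decomposition hO.
by exists cs, hs; split.
Qed.
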